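(* Let $T$ be a complete first-order theory with infinite models. Suppose that for every formula $\varphi(x,y)$ over $\emptyset$ with $x$ a single variable there is a formula $\theta_\varphi(x,z)$ such that for every $M \models T$, every finite $\varphi$-type $r(x)$ over $M$ and every finite set $A \subseteq M^{x}$ of realizations of $r$, there is some $b \in M^{z}$ such that $M \models \theta_\varphi(a,b)$ for all $a \in A$ and $\theta_\varphi(x,b) \vdash r(x)$. Then $T$ has TP$_2$, and $T$ has SOP$_n$ for all $n \geq 3$.
   Context: A $\varphi$-type is a consistent set of positive instances $\varphi(x,c)$ of $\varphi(x,y)$ (instances of $\neg\varphi$ are not included). $M^{x}$ denotes the set of tuples from $M$ of the length of $x$. A formula $\varphi(x;y)$ has TP$_2$ if there are an array of tuples $(a_{i,j})_{i,j<\omega}$ and $k<\omega$ such that for all $f:\omega\to\omega$, $\{\varphi(x;a_{i,f(i)}) : i<\omega\}$ is consistent, and for all $i<\omega$, $\{\varphi(x;a_{i,j}) : j<\omega\}$ is $k$-inconsistent. $T$ has TP$_2$ if some formula has TP$_2$ modulo $T$. For $n \geq 3$, $T$ has SOP$_n$ if there is a formula $\varphi(x;y)$ and a sequence of tuples $\langle a_i : i<\omega\rangle$ (in a model of $T$) such that $\models \varphi(a_i;a_j)$ if and only if $i<j$, and $\{\varphi(x_i,x_{i+1}) : i<n-1\} \cup \{\varphi(x_{n-1},x_0)\}$ is inconsistent with $T$. *)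

(* Defs.v *)
From mathcomp Require Import all_boot.
From mathcomp Require Import boolp classical_sets functions cardinality.

Set Implicit Arguments.
Unset Strict Implicit.
Unset Printing Implicit Defensive.

Local Open Scope classical_set_scope.

(** * Syntax of first-order logic with equality *)

Record language := Language {
  fsym : Type;
  far : fsym -> nat;
  rsym : Type;
  rar : rsym -> nat }.

(* [V] is the type of the variables that may occur free.  A sentence is a
   [formula L void]; a formula phi(x, y) with |x| = n and |y| = m is a
   [formula L ('I_n + 'I_m)]; a formula over M (with parameters from M) in
   variables x with |x| = n is a [formula L ('I_n + M)], the elements of M
   being used as names of themselves. *)
Inductive term (L : language) (V : Type) : Type :=
| Var of V
| App (f : fsym L) of ('I_(far f) -> term L V).

(* In [All phi] the bound variable is [None]. *)
Inductive formula (L : language) (V : Type) : Type :=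
| Fal
| Eq of term L V & term L V
| Rel (R : rsym L) of ('I_(rar R) -> term L V)
| Imp of formula L V & formula L V
| All of formula L (option V).

Arguments Fal {L V}.
Arguments App {L V} f _.
Arguments Rel {L V} R _.

Definition Not L (V : Type) (phi : formula L V) : formula L V := Imp phi Fal.

Fixpoint term_rename L (V W : Type) (s : V -> W) (t : term L V) : term L W :=
  match t with
  | Var v => Var L (s v)
  | App f ts => App f (fun i => term_rename s (ts i))
  end.

(* A variable-for-variable (or parameter-for-variable) substitution. *)
Fixpoint rename L (V : Type) (phi : formula L V) :
    forall W : Type, (V -> W) -> formula L W :=
  match phi with
  | Fal => fun W s => Fal
  | Eq t u => fun W s => Eq (term_rename s t) (term_rename s u)
  | Rel R ts => fun W s => Rel R (fun i => term_rename s (ts i))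
  | Imp p q => fun W s => Imp (rename p s) (rename q s)
  | All p => fun W s => All (rename p (omap s))
  end.

Definition assign (A B C : Type) (f : A -> C) (g : B -> C) (s : A + B) : C :=
  match s with inl a => f a | inr b => g b end.

(** * Semantics *)

Record structure (L : language) := Structure {
  carrier :> Type;
  nonempty : inhabited carrier;
  finterp : forall f : fsym L, ('I_(far f) -> carrier) -> carrier;
  rinterp : forall R : rsym L, ('I_(rar R) -> carrier) -> Prop }.

Fixpoint eval L (M : structure L) (V : Type) (e : V -> M) (t : term L V) : M :=
  match t with
  | Var v => e v
  | App f ts => finterp (fun i => eval e (ts i))
  end.

Fixpoint sat L (M : structure L) (V : Type) (phi : formula L V) : (V -> M) -> Prop :=
  match phi with
  | Fal => fun=> False
  | Eq t u => fun e => eval e t = eval e u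
  | Rel R ts => fun e => rinterp (fun i => eval e (ts i))
  | Imp p q => fun e => sat p e -> sat q e
  | All p => fun e => forall d : M, sat p (oapp e d)
  end.

Definition holds L (M : structure L) (s : formula L void) : Prop :=
  sat s (of_void M).

Definition theory L := set (formula L void).

Definition models L (M : structure L) (T : theory L) : Prop :=
  forall s, T s -> holds M s.

Definition tentails L (T : theory L) (s : formula L void) : Prop :=
  forall M : structure L, models M T -> holds M s.

Definition complete L (T : theory L) : Prop :=
  (exists M : structure L, models M T) /\
  forall s, tentails T s \/ tentails T (Not s).

Definition consistent_with L (V : Type) (T : theory L) (S : set (formula L V)) :
    Prop :=
  exists (N : structure L) (e : V -> N),
    models N T /\ forall psi, S psi -> sat psi e.

Definition elementary L (M N : structure L) (h : M -> N) : Prop :=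
  forall n (phi : formula L 'I_n) (e : 'I_n -> M),
    sat phi (h \o e) <-> sat phi e.

(** * Sets of formulas over M: consistency and entailment are taken modulo
    the elementary diagram of M, i.e. in elementary extensions of M. *)

Section OverM.
Variables (L : language) (M : structure L) (n : nat).
Implicit Types S r : set (formula L ('I_n + M)).

Definition realizes (a : 'I_n -> M) S : Prop :=
  forall psi, S psi -> sat psi (assign a id).

Definition realizes_in (N : structure L) (h : M -> N) (a : 'I_n -> N) S : Prop :=
  forall psi, S psi -> sat psi (assign a h).

Definition consistent S : Prop :=
  exists (N : structure L) (h : M -> N) (a : 'I_n -> N),
    elementary h /\ realizes_in h a S.

Definition entails S r : Prop :=
  forall (N : structure L) (h : M -> N) (a : 'I_n -> N),
    elementary h -> realizes_in h a S -> realizes_in h a r.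

(* phi(x, c) *)
Definition inst m (phi : formula L ('I_n + 'I_m)) (c : 'I_m -> M) :
    formula L ('I_n + M) :=
  rename phi (assign inl (inr \o c)).

Definition phi_type m (phi : formula L ('I_n + 'I_m)) r : Prop :=
  consistent r /\ forall psi, r psi -> exists c, psi = inst phi c.

(* k-inconsistency of an indexed family: k formulas with distinct indices are
   never jointly consistent (repetitions in the family are counted). *)
Definition k_inconsistent k (F : nat -> formula L ('I_n + M)) : Prop :=
  forall J : 'I_k -> nat, injective J -> ~ consistent (range (F \o J)).

End OverM.

(** * TP_2 and SOP_n *)

Definition formula_TP2 L (T : theory L) n m (phi : formula L ('I_n + 'I_m)) :
    Prop :=
  exists (M : structure L) (a : nat -> nat -> 'I_m -> M) (k : nat),
    [/\ models M T,
        forall f : nat -> nat, consistent (range (fun i => inst phi (a i (f i))))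
      & forall i, k_inconsistent k (fun j => inst phi (a i j))].

Definition TP2 L (T : theory L) : Prop :=
  exists n m (phi : formula L ('I_n + 'I_m)), formula_TP2 T phi.

(* phi(x_i, x_j), where x_0, x_1, ... are pairwise disjoint m-tuples of
   variables, the p-th variable of x_i being (i, p). *)
Definition inst_var L m (phi : formula L ('I_m + 'I_m)) (i j : nat) :
    formula L (nat * 'I_m) :=
  rename phi (assign (pair i) (pair j)).

Definition cycle_formulas L m (phi : formula L ('I_m + 'I_m)) (n : nat) :
    set (formula L (nat * 'I_m)) :=
  [set inst_var phi i i.+1 | i in [set i | (i < n.-1)%N]]
  `|` [set inst_var phi n.-1 0].

Definition SOP L (n : nat) (T : theory L) : Prop :=
  exists m (phi : formula L ('I_m + 'I_m))
         (M : structure L) (a : nat -> 'I_m -> M),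
    [/\ models M T,
        forall i j, sat phi (assign (a i) (a j)) <-> (i < j)%N
      & ~ consistent_with T (cycle_formulas phi n)].

(* Main.v *)
(** The hypothesis turns every [phi] into some [theta] interpolating it: for
    finite [A] inside finitely many sets [phi(M, c)], some [theta(M, b)] lies
    between [A] and their intersection. For [phi(x, y)] := [x <> y] this says
    that any finite set is separated by [theta] from any disjoint finite set.

    TP_2: take distinct elements [d_ij] and code the row [{d_ij : j}] by [c_i].
    Interpolating [theta(x, y) -> x = w] yields, for each path [f], a code [b]
    of [{d_(i,f(i)) : i}] that meets the set coded by [c_i] in [d_(i,f(i))] only;
    the formula saying so has 2-inconsistent rows.

    SOP_n: iterate the interpolation, [theta_(k+1)] interpolating [theta_k]
    with [theta_0] separating finite sets. Let [a_i] consist of [d_(i+1)] and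
    of codes of sets [S_k(i)], [k < n], that contain [d_0 .. d_i], where
    [S_0(i)] omits [d_(i+1), d_(i+2) ..] and [S_(k+1)(i)] is included in
    [S_k(j)] for [i <= j]. These inclusions, together with the membership of
    [d_(i+1)] in [S_(n-1)(j)] and not in [S_0(i)], define [i < j]; along an
    n-cycle [a_0 .. a_(n-1)] the marker of [a_0] would descend from
    [S_(n-1)(1)] to [S_0(0)].

    Both configurations exist in any finite size, and an ultrapower over [nat]
    makes them infinite. *)

Require Import Defs.
From mathcomp Require Import all_boot.
From mathcomp Require Import boolp classical_sets functions cardinality filter.
From mathcomp Require Import zify.

Set Implicit Arguments.
Unset Strict Implicit.
Unset Printing Implicit Defensive.

Local Open Scope classical_set_scope.

(** * Renaming of variables and finite conjunctions *)

Lemma eval_rename L (M : structure L) V W (s : V -> W) (t : term L V)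
    (e : W -> M) :
  eval e (term_rename s t) = eval (e \o s) t.
Proof.
elim: t => [//|f ts IH] /=; congr finterp.
by apply/funext => i; exact: IH.
Qed.

Lemma sat_rename L (M : structure L) V (phi : formula L V) W (s : V -> W)
    (e : W -> M) :
  sat (rename phi s) e <-> sat phi (e \o s).
Proof.
elim: phi W s e => {V} [|V t u|V R ts|V p IHp q IHq|V p IH] W s e //=.
- by rewrite !eval_rename.
- by under eq_fun do rewrite eval_rename.
- by rewrite IHp IHq.
- have Ed d : oapp e d \o omap s = oapp (e \o s) d by apply/funext; case.
  by split=> H d; move: (H d); rewrite IH Ed.
Qed.

Definition And L V (p q : formula L V) : formula L V := Not (Imp p (Not q)).

Lemma sat_And L (M : structure L) V (p q : formula L V) (e : V -> M) :
  sat (And p q) e <-> sat p e /\ sat q e.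
Proof.
split=> /= [H|[sp sq] /(_ sp sq)//].
by split; apply: contrapT => n; apply: H.
Qed.

Definition Conj L V (I : finType) (F : I -> formula L V) : formula L V :=
  foldr (fun i => And (F i)) (Not Fal) (enum I).

Lemma sat_Conj L (M : structure L) V (I : finType) (F : I -> formula L V)
    (e : V -> M) :
  sat (Conj F) e <-> forall i, sat (F i) e.
Proof.
suff H (s : seq I) : sat (foldr (fun i => And (F i)) (Not Fal) s) e <->
    forall i, i \in s -> sat (F i) e.
  by rewrite H; split=> G i; [apply: G; rewrite mem_enum|].
elim: s => [|j s IH]; first by split=> // _ [].
rewrite [foldr _ _ _]/= sat_And IH; split=> [[Hj Hs] i|H].
  by rewrite inE => /predU1P[->//|/Hs].
by split=> [|i si]; apply: H; rewrite inE ?eqxx// si orbT.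
Qed.

(** * Ultrapowers *)

Section Ultrapower.
Variables (L : language) (M : structure L) (I : Type) (U : set_system I).
Hypothesis UU : UltraFilter U.

Let UF : ProperFilter U := @ultra_proper _ _ UU.

Let agree (f g : I -> M) : Prop := U [set n | f n = g n].

Let agreexx f : agree f f.
Proof. by apply: filterS filterT => n. Qed.

Let agreeC f g : agree f g -> agree g f.
Proof. by apply: filterS => n /= ->. Qed.

Let agree_trans f g h : agree f g -> agree g h -> agree f h.
Proof. by apply: filterS2 => n /= -> ->. Qed.

(** A class is the set of its members, so that equivalent sequences have equal classes. *)
Let ultra_carrier := {A : set (I -> M) | exists f, A = agree f}.

Let cls (f : I -> M) : ultra_carrier := exist _ (agree f) (ex_intro _ f erefl).

Let rep (x : ultra_carrier) : I -> M := projT1 (cid (proj2_sig x)).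

Let repK : cancel rep cls.
Proof.
move=> [A HA]; apply: eq_exist; rewrite /rep; case: cid => f /= ->//.
Qed.

Let clsP f g : cls f = cls g <-> agree f g.
Proof.
split=> [/(congr1 sval)/= ->//|fg]; apply/eq_exist/predeqP => h.
by split; apply: agree_trans => //; exact: agreeC.
Qed.

Let rep_cls f : agree (rep (cls f)) f.
Proof. by apply/clsP; rewrite repK. Qed.

Definition ultrapower : structure L := @Structure L ultra_carrier
  (let: inhabits x := Defs.nonempty M in inhabits (cls (fun=> x)))
  (fun f xs => cls (fun n => finterp (fun i => rep (xs i) n)))
  (fun R xs => U [set n | rinterp (fun i => rep (xs i) n)]).

Definition ultra_class : (I -> M) -> ultrapower := cls.

(** Arities are finite, so one set of [U] serves all arguments of a symbol at once. *)
Let all_rep (J : finType) (g : J -> I -> M) :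
  U [set n | forall j, rep (cls (g j)) n = g j n].
Proof.
apply: (@filter_forall _ J (fun j n => rep (cls (g j)) n = g j n)).
by move=> j; exact: rep_cls.
Qed.

Lemma eval_ultrapower V (t : term L V) (e : V -> I -> M) :
  eval (ultra_class \o e) t = ultra_class (fun n => eval (e^~ n) t).
Proof.
elim: t => [//|f ts IH] /=; apply/clsP.
under [X in agree (fun n => finterp (fun i => rep (X i) n))]eq_fun do rewrite IH.
apply: filterS (all_rep (fun i n => eval (e^~ n) (ts i))) => n /= H.
by congr finterp; apply/funext => i; exact: H.
Qed.

Lemma ultraN (A : set I) : U (~` A) <-> ~ U A.
Proof.
split=> [nA UA|nA]; last by have [] := in_ultra_setVsetC A UU.
by have [x [/= nAx Ax]] := filter_ex (filterI nA UA).
Qed.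

(** Łoś's theorem, by induction on [phi]. Maximality of [U] enters in the case of implication. *)
Lemma sat_ultrapower V (phi : formula L V) (e : V -> I -> M) :
  sat phi (ultra_class \o e) <-> U [set n | sat phi (e^~ n)].
Proof.
elim: phi e => {V} [V|V t u|V R ts|V p IHp q IHq|V p IH] e.
- by split=> // /filter_ex[].
- change (eval (ultra_class \o e) t = eval (ultra_class \o e) u <->
    U [set n | eval (e^~ n) t = eval (e^~ n) u]).
  by rewrite !eval_ultrapower; exact: clsP.
- change (U [set n | rinterp (fun i => rep (eval (ultra_class \o e) (ts i)) n)]
    <-> U [set n | rinterp (fun i => eval (e^~ n) (ts i))]).
  have H : U [set n | forall i,
      rep (eval (ultra_class \o e) (ts i)) n = eval (e^~ n) (ts i)].
    apply: (@filter_forall _ _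
      (fun i n => rep (eval (ultra_class \o e) (ts i)) n = _)) => i.
    by rewrite eval_ultrapower; exact: rep_cls.
  by split; apply: filterS2 H => n /= /funext ->.
- rewrite /= IHp IHq; split=> [pq|]; last first.
    by move=> /filterS2 + Up; apply; [|exact: Up] => n /= + ?; exact.
  have [Up|/ultraN] := pselect (U [set n | sat p (e^~ n)]).
    by apply: filterS (pq Up) => n /=.
  by apply: filterS => n /= + ?.
- have IHd (d : I -> M) : sat p (oapp (ultra_class \o e) (ultra_class d)) <->
      U [set n | sat p (oapp (e^~ n) (d n))].
    have -> : oapp (ultra_class \o e) (ultra_class d) =
        ultra_class \o (fun o => oapp e d o) by apply/funext; case.
    rewrite IH; have -> // : (fun n => sat p ((fun o => oapp e d o)^~ n)) =
        (fun n => sat p (oapp (e^~ n) (d n))).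
    by apply/funext => n; congr sat; apply/funext; case.
  split=> [H|H d]; last first.
    by rewrite -(repK d); apply/IHd; apply: filterS H => n /=; exact.
  (* [d n] is a counterexample at coordinate [n] whenever there is one, so the class of [d] alone
     tests the universal formula. *)
  have /choice[d Hd] : forall n, exists x,
      sat p (oapp (e^~ n) x) -> sat (All p) (e^~ n).
    move=> n.
    have [a|] := pselect (sat (All p) (e^~ n)).
      by case: (Defs.nonempty M) => x; exists x.
    by move=> /existsNP[x nx]; exists x => /nx.
  by have /IHd := H (ultra_class d); apply: filterS => n /=; exact: Hd.
Qed.

End Ultrapower.

(* This replaces compactness: the values of [q] at sequences realize whatever
   the terms of the sequences eventually satisfy. *)
Lemma countable_limit L (M : structure L) :
  exists (N : structure L) (q : (nat -> M) -> N),
    (forall T, models M T -> models N T) /\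
    forall V (phi : formula L V) (e : V -> nat -> M) n0,
      (forall n, (n0 <= n)%N -> sat phi (e^~ n)) -> sat phi (q \o e).
Proof.
(* Such a [U] contains every final segment of [nat]. *)
have [U [UU leU]] := ultraFilterLemma eventually_filter.
pose N := ultrapower M U; pose q : (nat -> M) -> N := @ultra_class _ M _ U.
have lim V (phi : formula L V) (e : V -> nat -> M) n0 :
    (forall n, (n0 <= n)%N -> sat phi (e^~ n)) -> sat phi (q \o e).
  by move=> H; apply/sat_ultrapower/leU; exists n0.
exists N, q; split=> // T MT s Ts.
rewrite /holds; have -> : of_void N = q \o of_void (nat -> M) by apply/funext; case.
apply: (lim _ _ _ 0) => n _.
by have -> : (of_void (nat -> M))^~ n = of_void M; [apply/funext; case|exact: MT].
Qed.

(** * Interpolation *)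

Definition fiber L (M : structure L) Y (phi : formula L (option Y))
    (c : Y -> M) : set M := [set x | sat phi (oapp c x)].

(* Nonemptiness of [A] is what makes the [phi]-type given by [C] consistent. *)
Definition interpolates L (T : theory L) Y Z (phi : formula L (option Y))
    (theta : formula L (option Z)) : Prop :=
  forall M : structure L, models M T ->
  forall (A : set M) (C : set (Y -> M)),
    finite_set A -> finite_set C -> A !=set0 ->
    (forall c, C c -> A `<=` fiber phi c) ->
  exists b, A `<=` fiber theta b /\
    forall c, C c -> fiber theta b `<=` fiber phi c.

Definition uniform_finite_types L (T : theory L) : Prop :=
  forall m (phi : formula L ('I_1 + 'I_m)),
    exists l (theta : formula L ('I_1 + 'I_l)),
      forall M : structure L, models M T ->
      forall r : set (formula L ('I_1 + M)), phi_type phi r -> finite_set r ->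
      forall A : set ('I_1 -> M), finite_set A ->
        (forall a, A a -> realizes a r) ->
      exists b : 'I_l -> M,
        (forall a, A a -> sat theta (assign a b)) /\
        entails [set inst theta b] r.

Lemma sat_inst L (M N : structure L) (h : M -> N) n m
    (phi : formula L ('I_n + 'I_m)) c a :
  sat (inst phi c) (assign a h) <-> sat phi (assign a (h \o c)).
Proof.
rewrite /inst sat_rename; have -> // : assign a h \o assign inl (inr \o c) =
  assign a (h \o c) by apply/funext; case.
Qed.

Lemma elementary_id L (M : structure L) : elementary (@id M).
Proof. by []. Qed.

Lemma elementary_inj L (M N : structure L) (h : M -> N) :
  elementary h -> injective h.
Proof.
move=> hel x y hxy; pose e (i : 'I_2) := if i == ord0 then x else y.
have /= H := hel 2 (Eq (Var L ord0) (Var L (lift ord0 ord0))) e.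
by apply/H.
Qed.

(** The instances of [phi] at [C] form a finite [phi]-type, realized in [M] itself by any point of
    [A]. Entailment, read in the trivial extension of [M], becomes inclusion of fibers. *)
Lemma uniform_interpolation L (T : theory L) : uniform_finite_types T ->
  forall (Y : finType) (phi : formula L (option Y)),
  exists (Z : finType) (theta : formula L (option Z)), interpolates T phi theta.
Proof.
move=> dft Y phi.
pose s (o : option Y) : 'I_1 + 'I_#|Y| :=
  if o is Some y then inr (enum_rank y) else inl ord0.
have satphi (M : structure L) x (c : Y -> M) :
    sat (rename phi s) (assign (fun=> x) (c \o enum_val)) <-> fiber phi c x.
  rewrite sat_rename; have -> // : assign (fun=> x) (c \o enum_val) \o s =
    oapp c x by apply/funext; case=> //= y; rewrite enum_rankK.
have [l [theta Htheta]] := dft _ (rename phi s).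
exists 'I_l, (rename theta (assign (fun=> None) Some)).
move=> M MT A C fA fC [a0 Aa0] AC.
have sattheta x (b : 'I_l -> M) :
    fiber (rename theta (assign (fun=> None) Some)) b x <->
    sat theta (assign (fun=> x) b).
  rewrite /fiber/= sat_rename; have -> // :
    oapp b x \o assign (fun=> None) Some = assign (fun _ : 'I_1 => x) b.
  by apply/funext; case.
pose r := [set inst (rename phi s) (c \o enum_val) | c in C].
have Ar a : A a -> realizes (fun=> a) r.
  move=> Aa _ [c Cc <-]; apply/sat_inst; apply/satphi.
  exact: AC Cc _ Aa.
have [|||a [x Ax <-]|b [Ab br]] :=
    Htheta M MT r _ _ [set (fun=> x) | x in A].
- split=> [|_ [c _ <-]]; last by eexists.
  by exists M, id, (fun=> a0); split; [exact: elementary_id|exact: Ar].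
- exact: finite_image.
- exact: finite_image.
- exact: Ar.
exists b; split=> [x Ax|c Cc x /sattheta xb].
  by apply/sattheta; apply: Ab; exists x.
apply/satphi; suff /sat_inst : sat (inst (rename phi s) (c \o enum_val))
  (assign (fun=> x) id) by [].
apply: (br M id); [exact: elementary_id| |by exists c].
by move=> _ ->; apply/sat_inst.
Qed.

(** * From finite types of variables to ordinals *)

Section FinTypeVariables.
Variables (L : language) (X Y : finType).

Definition ordinal_vars (phi : formula L (X + Y)) :
    formula L ('I_#|X| + 'I_#|Y|) :=
  rename phi (assign (inl \o enum_rank) (inr \o enum_rank)).

Lemma sat_ordinal_vars (M : structure L) (phi : formula L (X + Y)) a b :
  sat (ordinal_vars phi) (assign a b) <->
  sat phi (assign (a \o enum_rank) (b \o enum_rank : Y -> M)).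
Proof.
rewrite sat_rename; set e := _ \o _; set e' := assign _ _.
by have -> : e = e' by apply/funext; case.
Qed.

End FinTypeVariables.

Lemma enum_valK_fun (X : finType) M (a : X -> M) : a \o enum_val \o enum_rank = a.
Proof. by apply/funext => x /=; rewrite enum_rankK. Qed.

(** The last hypothesis yields 2-inconsistent rows; it ranges over elementary extensions because
    consistency over [M] is witnessed there. *)
Lemma TP2_finType L (T : theory L) (X Y : finType) (psi : formula L (X + Y))
    (M : structure L) (a : nat -> nat -> Y -> M) :
  models M T ->
  (forall f : nat -> nat, exists x, forall i, sat psi (assign x (a i (f i)))) ->
  (forall (N : structure L) (h : M -> N) x i j j', elementary h ->
     sat psi (assign x (h \o a i j)) -> sat psi (assign x (h \o a i j')) ->
     j = j') ->
  TP2 T.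
Proof.
move=> MT paths rows; exists _, _, (ordinal_vars psi), M.
exists (fun i j => a i j \o enum_val), 2; split=> // [f|i J Jinj].
  have [x Hx] := paths f; exists M, id, (x \o enum_val).
  split; first exact: elementary_id.
  move=> _ [i _ <-]; apply/sat_inst/sat_ordinal_vars.
  by rewrite enum_valK_fun enum_valK_fun.
move=> [N [h [x [hel Hx]]]].
suff /Jinj : J ord0 = J (lift ord0 ord0) by [].
have H u : sat psi (assign (x \o enum_rank) (h \o a i (J u))).
  have /sat_inst/sat_ordinal_vars : sat (inst (ordinal_vars psi)
    (a i (J u) \o enum_val)) (assign x h) by apply: Hx; exists u.
  by rewrite compA enum_valK_fun.
exact: rows hel (H _) (H _).
Qed.

Lemma SOP_finType L (T : theory L) (X : finType) (phi : formula L (X + X)) n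
    (M : structure L) (a : nat -> X -> M) :
  models M T ->
  (forall i j, sat phi (assign (a i) (a j)) <-> (i < j)%N) ->
  (forall (N : structure L) (c : nat -> X -> N),
     (forall i, (i < n.-1)%N -> sat phi (assign (c i) (c i.+1))) ->
     ~ sat phi (assign (c n.-1) (c 0))) ->
  SOP n T.
Proof.
move=> MT lin nocycle; exists _, (ordinal_vars phi), M.
exists (fun i => a i \o enum_val); split=> // [i j|[N [e [_ He]]]].
  by rewrite -lin sat_ordinal_vars !enum_valK_fun.
pose c i x := e (i, enum_rank x).
have inst_c i j : sat (inst_var (ordinal_vars phi) i j) e ->
    sat phi (assign (c i) (c j)).
  rewrite /inst_var sat_rename; have -> : e \o assign (pair i) (pair j) =
    assign (e \o pair i) (e \o pair j) by apply/funext; case.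
  by move/sat_ordinal_vars.
apply: (nocycle N c) => [i lt_i|]; apply/inst_c/He; last by right.
by left; exists i.
Qed.

(** * Coded sets: separation and membership *)

Definition separates L (T : theory L) Z (theta : formula L (option Z)) : Prop :=
  forall M : structure L, models M T ->
  forall A C : set M, finite_set A -> finite_set C -> A !=set0 ->
    A `<=` ~` C -> exists b, A `<=` fiber theta b /\ fiber theta b `<=` ~` C.

Lemma separating_formula L (T : theory L) : uniform_finite_types T ->
  exists (Z : finType) (theta : formula L (option Z)), separates T theta.
Proof.
move=> dft; pose neq := Not (Eq (Var L None) (Var L (Some tt))).
have [Z [theta Htheta]] := uniform_interpolation dft neq.
exists Z, theta => M MT A C fA fC A0 AC.
have [_ [c Cc <-] x Ax xc|b [Ab bC]] :=
    Htheta M MT A [set (fun=> c) | c in C] fA (finite_image _ fC) A0.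
  by apply: (AC x Ax); rewrite (xc : x = c).
by exists b; split=> // x xb Cx; apply: (bC (fun=> x) _ x xb); [exists x|].
Qed.

(** The tuple [f] is read as the code of a set, of which [v] is to be an element. *)
Definition member L V Z (theta : formula L (option Z)) (f : Z -> V) (v : V) :
    formula L V := rename theta (oapp f v).

Lemma sat_member L (M : structure L) V Z (theta : formula L (option Z))
    (f : Z -> V) v (e : V -> M) :
  sat (member theta f v) e <-> fiber theta (e \o f) (e v).
Proof.
rewrite sat_rename /fiber/=; have -> // : e \o oapp f v = oapp (e \o f) (e v).
by apply/funext; case.
Qed.

Lemma infinite_injection T :
  infinite_set [set: T] -> exists d : nat -> T, injective d.
Proof.
elim/Ppointed: T => T; first by rewrite emptyE => /infinite_setN0[].
by move=> /infiniteP/pcard_injP[d dinj]; exists d => x y; apply: dinj; rewrite inE.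
Qed.

(** * The tree property of the second kind *)

(** The variables in [W] code a path, those in [Z] code a row, and [unit] holds the element selected
    in that row. *)
Definition meets_only L (Z W : finType) (theta : formula L (option Z))
    (eta : formula L (option W)) : formula L (W + (Z + unit)) :=
  And (member eta inl (inr (inr tt)))
  (And (member theta (inr \o inl) (inr (inr tt)))
    (All (Imp (member eta (Some \o inl) None)
      (Imp (member theta (Some \o inr \o inl) None)
        (Eq (Var L None) (Var L (Some (inr (inr tt))))))))).

Lemma sat_meets_only L (M : structure L) (Z W : finType)
    (theta : formula L (option Z)) (eta : formula L (option W))
    (e : W + (Z + unit) -> M) (w := e (inr (inr tt))) :
  sat (meets_only theta eta) e <->
  fiber eta (e \o inl) `&` fiber theta (e \o inr \o inl) = [set w].
Proof.
rewrite !sat_And !sat_member; split=> [[etaw [thetaw H]]|E].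
  rewrite eqEsubset; split=> [d [etad thetad]|_ ->//].
  by apply: (H d); apply/sat_member.
have [etaw thetaw] : (fiber eta (e \o inl) `&` fiber theta (e \o inr \o inl)) w.
  by rewrite E.
do 2?split=> //; move=> d /sat_member etad /sat_member thetad.
by have : [set w] d by rewrite -E.
Qed.

Lemma TP2_of_uniform_finite_types L (T : theory L) (M : structure L) :
  uniform_finite_types T -> models M T -> infinite_set [set: M] -> TP2 T.
Proof.
move=> dft MT /infinite_injection[d0 d0_inj].
pose d (i j : nat) := d0 (pickle (i, j)).
have d_inj i j i' j' : d i j = d i' j' -> i = i' /\ j = j'.
  by move=> /d0_inj/(pcan_inj pickleK)[].
have [Z [theta sep]] := separating_formula dft.
pose phi : formula L (option (Z + unit)) :=
  Imp (member theta (Some \o inl) None) (Eq (Var L None) (Var L (Some (inr tt)))).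
have [W [eta Heta]] := uniform_interpolation dft phi.
(* Only finite sets can be coded: stage [n] treats the indices up to [n], and the stages are merged
   by a limit at the end. *)
pose square n := [set ij : nat * nat | (ij.1 <= n)%N /\ (ij.2 <= n)%N].
have fin_square n : finite_set (square n).
  have -> : square n = `I_n.+1 `*` `I_n.+1 by [].
  by apply: finite_setX; exact: finite_II.
have /choice[c Hc] (i : nat) : exists c : nat -> Z -> M, forall n,
    (forall j, (j <= n)%N -> fiber theta (c n) (d i j)) /\
    (forall i' j, i' != i -> (i' <= n)%N -> (j <= n)%N ->
       ~ fiber theta (c n) (d i' j)).
  suff /choice[c Hc] : forall n, exists c : Z -> M,
    (forall j, (j <= n)%N -> fiber theta c (d i j)) /\
    (forall i' j, i' != i -> (i' <= n)%N -> (j <= n)%N ->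
       ~ fiber theta c (d i' j)) by exists c.
  move=> n.
  have [|||x [j jn <-] [[i' j'] [[/= i'n j'n] i'i] /d_inj[/eqP]]|b [b1 b2]] :=
      sep M MT
    [set d i j | j in `I_n.+1]
    [set d ij.1 ij.2 | ij in square n `&` [set ij | ij.1 != i]].
  - exact: finite_image.
  - exact/finite_image/finite_setIl.
  - by exists (d i 0), 0.
  - by move=> ii _; move: i'i; rewrite ii.
  exists b; split=> [j jn|i' j i'i i'n jn /b2]; first by apply: b1; exists j.
  by apply; exists (i', j).
have paths (f : nat -> nat) : exists b : nat -> W -> M,
    forall n, (f 0 <= n)%N -> forall i, (i <= n)%N -> (f i <= n)%N ->
    fiber eta (b n) `&` fiber theta (c i n) = [set d i (f i)].
  suff /choice[b Hb] : forall n, exists b : W -> M,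
      (f 0 <= n)%N -> forall i, (i <= n)%N -> (f i <= n)%N ->
      fiber eta b `&` fiber theta (c i n) = [set d i (f i)] by exists b.
  (* [f 0 <= n] puts [0] in [D] below, so the set to be coded is nonempty; otherwise any value will
     do. *)
  move=> n; have [f0n|_] := leqP (f 0) n; last by exists (fun=> d0 0).
  pose D := [set i | (i <= n)%N /\ (f i <= n)%N].
  have fin_D : finite_set D by apply: (@finite_setIl _ `I_n.+1).
  have [|||_ [i [lein lefn] <-] _ [i' [lei'n lef'n] <-]|b [b1 b2]] := Heta M MT
    [set d i (f i) | i in D]
    [set assign (c i n) (fun=> d i (f i)) | i in D].
  - exact: finite_image.
  - exact: finite_image.
  - by exists (d 0 (f 0)), 0.
  (* The code of row [i] excludes path elements from other rows. *)
  - move=> /sat_member mem; have [->//|ii'] := eqVneq i' i.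
    by case: ((Hc i n).2 i' (f i') ii' lei'n lef'n mem).
  exists b => _ i lein lefn; rewrite eqEsubset; split=> [x [xb xc]|_ ->].
    have := b2 _ (imageP _ (conj lein lefn : D i)) x xb; apply.
    exact/sat_member.
  by split; [apply: b1; exists i|exact: (Hc i n).1].
have [N [q [NT lim]]] := countable_limit M.
(* The limiting code depends on the row alone; only the selected element varies with [j]. *)
pose a i j := assign (q \o (fun z n => c i n z)) (fun _ : unit => q (fun=> d i j)).
apply: (@TP2_finType _ T _ _ (meets_only theta eta) N a) => [|f|K h x i j j' hel].
- exact: NT.
- have [b Hb] := paths f; exists (q \o (fun w n => b n w)) => i.
  pose e := assign (fun w n => b n w)
    (assign (fun z n => c i n z) (fun (_ : unit) (_ : nat) => d i (f i))).
  have -> : assign (q \o (fun w n => b n w)) (a i (f i)) = q \o e.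
    by apply/funext => -[|[]].
  apply: (lim _ _ _ (f 0 + (i + f i))%N) => n len; apply/sat_meets_only.
  by apply: Hb; lia.
(* Both instances describe the same intersection, so their singletons coincide. *)
- move=> /sat_meets_only/= E /sat_meets_only/=.
  rewrite [X in X = _]E => /seteqP[/(_ _ erefl)/= + _].
  move=> /(elementary_inj hel) qE; apply: contrapT => jj'.
  apply: (lim bool (Not (Eq (Var L true) (Var L false)))
    (fun o (_ : nat) => if o then d i j else d i j') 0) => [_ _ /= /d_inj[]//|].
  by rewrite /= qE.
Qed.

(** * The strong order properties *)

Lemma interpolating_chain L (T : theory L) : uniform_finite_types T ->
  exists (Z : nat -> finType) (theta : forall k, formula L (option (Z k))),
    separates T (theta 0) /\ forall k, interpolates T (theta k) (theta k.+1).
Proof.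
move=> dft; have [Z0 [theta0 sep0]] := separating_formula dft.
(* The type of parameters changes at each step, so the iteration runs on pairs of a type and a
   formula. *)
have /choice[g Hg] : forall F : {Z : finType & formula L (option Z)},
    exists G : {Z : finType & formula L (option Z)},
      interpolates T (projT2 F) (projT2 G).
  move=> F; have [Z [theta H]] := uniform_interpolation dft (projT2 F).
  by exists (existT _ Z theta).
pose F k := iter k g (existT _ Z0 theta0).
by exists (fun k => projT1 (F k)), (fun k => projT2 (F k)).
Qed.

(** * Ladders of coded sets *)

Section Ladder.
Variables (L : language) (Z : nat -> finType).
Variable theta : forall k, formula L (option (Z k)).

(* [None] is the marker [d_(i+1)]. *)
Definition ladder_vars p : finType := option {k : 'I_p.+1 & Z k}.

Definition code p (k : 'I_p.+1) (z : Z k) : ladder_vars p :=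
  Some (Tagged (fun k : 'I_p.+1 => Z k) z).

Definition lower p (k : 'I_p) : 'I_p.+1 := Ordinal (leqW (ltn_ord k)).
Definition upper p (k : 'I_p) : 'I_p.+1 :=
  @Ordinal p.+1 k.+1 (ltn_ord k).

(** This is $S_k(i)$ when [a] is the tuple $a_i$. *)
Definition rung (M : structure L) p (a : ladder_vars p -> M) (k : 'I_p.+1) :
  set M := fiber (theta k) (a \o @code p k).

Definition ladder p : formula L (ladder_vars p + ladder_vars p) :=
  And (member (theta p) (inr \o @code p ord_max) (inl None))
  (And (Not (member (theta 0) (inl \o @code p ord0) (inl None)))
    (Conj (fun k : 'I_p => All
      (Imp (member (theta k.+1) (Some \o inl \o @code p (upper k)) None)
        (member (theta k) (Some \o inr \o @code p (lower k)) None))))).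

Lemma sat_ladder (M : structure L) p (a a' : ladder_vars p -> M) :
  sat (ladder p) (assign a a') <->
  [/\ rung a' ord_max (a None), ~ rung a ord0 (a None)
    & forall k : 'I_p, rung a (upper k) `<=` rung a' (lower k)].
Proof.
rewrite !sat_And sat_Conj sat_member /=.
rewrite (sat_member (theta 0) (inl \o @code p ord0) (inl None) (assign a a')).
split=> [[H1 [H2 H3]]|[H1 H2 H3]].
  split=> // k d /= dk; have /= := H3 k d.
  rewrite !sat_member; exact.
split=> //; split=> // k d /sat_member dk; apply/sat_member; exact: H3.
Qed.

Lemma ladder_acyclic (M : structure L) p (c : nat -> ladder_vars p -> M) :
  (forall i, (i < p)%N -> sat (ladder p) (assign (c i) (c i.+1))) ->
  ~ sat (ladder p) (assign (c p) (c 0)).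
Proof.
move=> step /sat_ladder[last0 lastN0 lastS].
(* For [p = 0] the cycle is a loop, and the top rung is also the bottom one. *)
case: p c step last0 lastN0 lastS => [|p] c step last0 lastN0 lastS.
  by apply: lastN0; have -> : ord0 = ord_max :> 'I_1 by exact/val_inj.
(* The marker of [c 0] starts in the top rung of [c 1] and loses one level per step. It reaches
   level 1 at [c p.+1], and the closing edge brings it to level 0 of [c 0]. *)
have descent t : (t <= p)%N -> forall k : 'I_p.+2, (k + t = p.+1)%N ->
    rung (c t.+1) k (c 0 None).
  elim: t => [_ k|t IH lt_tp k kt].
    rewrite addn0 => kE; have -> : k = ord_max by exact/val_inj.
    by have /sat_ladder[] := step 0 isT.
  have kp : (k < p.+1)%N by lia.
  have /sat_ladder[_ _ /(_ (Ordinal kp)) sub] := step t.+1 lt_tp.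
  have -> : k = lower (Ordinal kp) by exact/val_inj.
  by apply: sub; apply: IH; [exact: ltnW|rewrite /= addSn -addnS].
have /sat_ladder[_ notin _] := step 0 isT; apply: notin.
have -> : ord0 = lower (ord0 : 'I_p.+1) by exact/val_inj.
by apply: lastS; apply: descent => //=; rewrite add1n.
Qed.

(** The length is bounded by [N] because each interpolation handles only finitely many sets
    $S_k(j)$, those with [i <= j <= N]. *)
Lemma ladder_realized T (M : structure L) (d : nat -> M) p N :
  separates T (theta 0) -> (forall k, interpolates T (theta k) (theta k.+1)) ->
  models M T -> injective d ->
  exists a : nat -> ladder_vars p -> M,
    forall i j, (i <= N)%N -> (j <= N)%N ->
      sat (ladder p) (assign (a i) (a j)) <-> (i < j)%N.
Proof.
move=> sep chain MT dinj.
pose good k (B : nat -> Z k -> M) := forall i j, (j <= i)%N ->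
  fiber (theta k) (B i) (d j).
pose nested k (B : nat -> Z k -> M) (B' : nat -> Z k.+1 -> M) :=
  forall i j, (i <= j)%N -> (j <= N)%N ->
  fiber (theta k.+1) (B' i) `<=` fiber (theta k) (B j).
(* The bound is [N.+1] because the marker of the tuple at [N] is [d N.+1]. *)
have [B0 [good0 missB0]] : exists B0, good 0 B0 /\
    forall i j, (i < j)%N -> (j <= N.+1)%N -> ~ fiber (theta 0) (B0 i) (d j).
  suff /choice[B0 HB0] : forall i, exists b : Z 0 -> M,
      (forall j, (j <= i)%N -> fiber (theta 0) b (d j)) /\
      forall j, (i < j)%N -> (j <= N.+1)%N -> ~ fiber (theta 0) b (d j).
    by exists B0; split=> i; case: (HB0 i).
  move=> i.
  have [|||_ [j ji <-] [j' [ij' _] /dinj jj']|b [b1 b2]] := sep M MT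
      (d @` `I_i.+1) (d @` [set j | (i < j)%N /\ (j < N.+2)%N]).
  - exact: finite_image.
  - by apply: finite_image; apply: (@sub_finite_set _ _ `I_N.+2) => // j [].
  - by exists (d 0), 0.
  - by move: ji ij'; rewrite /= jj'; lia.
  exists b; split=> [j ji|j ij jN /b2]; first by apply: b1; exists j.
  by apply; exists j.
(* The premise [good k B] stands inside the existential so that the step is total and can be
   iterated by recursion. *)
have step k (B : nat -> Z k -> M) : exists B' : nat -> Z k.+1 -> M,
    good k B -> good k.+1 B' /\ nested k B B'.
  have [gB|] := pselect (good k B); last first.
    by case: (Defs.nonempty M) => x; exists (fun _ _ => x).
  suff /choice[B' HB'] : forall i, exists b : Z k.+1 -> M,
      (forall j, (j <= i)%N -> fiber (theta k.+1) b (d j)) /\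
      forall j, (i <= j)%N -> (j <= N)%N ->
        fiber (theta k.+1) b `<=` fiber (theta k) (B j).
    by exists B' => _; split=> i; case: (HB' i).
  move=> i.
  have [|||_ [j [ij _] <-] _ [j' j'i <-]|b [b1 b2]] := chain k M MT
      (d @` `I_i.+1) (B @` [set j | (i <= j)%N /\ (j < N.+1)%N]).
  - exact: finite_image.
  - by apply: finite_image; apply: (@sub_finite_set _ _ `I_N.+1) => // j [].
  - by exists (d 0), 0.
  - by apply: gB; move: j'i ij; rewrite /=; lia.
  exists b; split=> [j ji|j ij jN]; first by apply: b1; exists j.
  by apply: b2; exists j.
pose B := nat_rect (fun k => nat -> Z k -> M) B0
  (fun k B => sval (cid (step k B))).
have Bgood k : good k (B k).
  by elim: k => [//|k IH] /=; case: cid => B' /= /(_ IH)[].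
have Bnested k : nested k (B k) (B k.+1).
  by rewrite /=; case: cid => B' /= /(_ (Bgood k))[].
pose a i (o : ladder_vars p) := if o is Some kz then B (tag kz) i (tagged kz)
  else d i.+1.
have rungE i k : rung (a i) k = fiber (theta k) (B k i) by [].
exists a => i j leiN lejN; rewrite sat_ladder !rungE; split=> [[inj _ _]|ltij].
  rewrite ltnNge; apply/negP => leji; have : fiber (theta 0) (B 0 j) (d i.+1).
    (* The inclusions at the fixed index [j] carry the marker of [i] from $S_p(j)$ down to $S_0(j)$,
       which omits it when [j <= i]. *)
    have down k : (k <= p)%N -> fiber (theta (p - k)) (B (p - k) j) (d i.+1).
      elim: k => [|k IH] kp; first by rewrite subn0.
      apply: (Bnested _ j j) => //; rewrite -subSn//= subSS; exact/IH/ltnW.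
    by have := down p (leqnn p); rewrite subnn.
  by apply: missB0.
split=> [||k].
- exact: Bgood.
- exact: missB0.
- by apply: Bnested => //; exact: ltnW.
Qed.

End Ladder.

(** Levels [0] to [p] exclude cycles of length [p.+1]; the limit of the finite ladders supplies the
    infinite sequence. *)
Lemma SOP_of_uniform_finite_types L (T : theory L) (M : structure L) p :
  uniform_finite_types T -> models M T -> infinite_set [set: M] ->
  SOP p.+1 T.
Proof.
move=> dft MT /infinite_injection[d d_inj].
have [Z [theta [sep chain]]] := interpolating_chain dft.
have /choice[a Ha] N := ladder_realized p N sep chain MT d_inj.
have [N [q [NT lim]]] := countable_limit M.
pose b i := q \o (fun x n => a n i x).
apply: (@SOP_finType _ T (ladder_vars Z p) (ladder theta p) p.+1 N b).
- exact: NT.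
- move=> i j; pose e := assign (fun x n => a n i x) (fun x n => a n j x).
  have -> : assign (b i) (b j) = q \o e by apply/funext => -[].
  have e_n n : e^~ n = assign (a n i) (a n j) by apply/funext; case.
  split=> [satN|ltij].
    (* If [j <= i], the ladder formula fails at every stage from [i + j] on, and its negation passes
       to the limit as well. *)
    apply: contrapT => /negP; rewrite -leqNgt => leji.
    apply: (lim _ (Not (ladder theta p)) e (i + j)%N _ satN) => n len.
    change (~ sat (ladder theta p) (e^~ n)).
    by rewrite e_n Ha; lia.
  by apply: (lim _ _ e (i + j)%N) => n len; rewrite e_n Ha; lia.
- by move=> K c; exact: ladder_acyclic.
Qed.

Theorem proposition5p4 (L : language) (T : theory L)
  (Tcomplete : complete T)
  (Tinfinite : exists M : structure L, models M T /\ infinite_set [set: M])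
  (uniform : forall m (phi : formula L ('I_1 + 'I_m)),
    exists l (theta : formula L ('I_1 + 'I_l)),
      forall M : structure L, models M T ->
      forall r : set (formula L ('I_1 + M)), phi_type phi r -> finite_set r ->
      forall A : set ('I_1 -> M), finite_set A ->
        (forall a, A a -> realizes a r) ->
      exists b : 'I_l -> M,
        (forall a, A a -> sat theta (assign a b)) /\
        entails [set inst theta b] r) :
  TP2 T /\ (forall n, (3 <= n)%N -> SOP n T).
Proof.
have [M [MT Minf]] := Tinfinite.
split; first exact: TP2_of_uniform_finite_types Minf.
by case=> // p _; exact: SOP_of_uniform_finite_types Minf.
Qed.
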